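(* For $\delta\in(0,1)$ let $\Omega_\delta=(0,1)\times(\delta,1)$, with points $z=(\theta,r)$, and let $C_\delta^{\rm crit}$ be the best constant in the inequality $$\iint_{\Omega_\delta}\frac{u^2}{r}\,dz\le C_\delta^{\rm crit}\iint_{\Omega_\delta}r(\partial_r u)^2\,dz$$ for all $u\in H^1(\Omega_\delta)$ satisfying $u(\theta,1)=0$. Then $$C_\delta^{\rm crit}=\frac{4}{\pi^2}|\ln\delta|^2.$$ In particular, $C_\delta^{\rm crit}$ blows up at the logarithmic rate $|\ln\delta|^2$ as $\delta\to0^+$.
   Context: $H^1(\Omega_\delta)$ is the usual (unweighted) Sobolev space, and the condition $u(\theta,1)=0$ is understood in the sense of traces on the side $\{r=1\}$. ''Best constant'' means the smallest constant for which the inequality holds for all admissible $u$. *)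

(* Defs.v *)
From HB Require Import structures.
From mathcomp Require Import all_boot all_order all_algebra.
From mathcomp Require Import all_classical all_reals all_analysis.

Set Implicit Arguments.
Unset Strict Implicit.
Unset Printing Implicit Defensive.

Import Order.TTheory GRing.Theory Num.Theory.
Import numFieldNormedType.Exports.

Local Open Scope classical_set_scope.
Local Open Scope ring_scope.

(* Points of the plane are z = (theta, r) : R * R. *)

Definition leb1 (R : realType) : {measure set (measurableTypeR R) -> \bar R} :=
  @lebesgue_measure R.

Definition leb2 (R : realType) :
    {measure set (measurableTypeR R * measurableTypeR R) -> \bar R} :=
  (@lebesgue_measure R \x @lebesgue_measure R)%E.

Definition e_theta (R : realType) : R * R := (1, 0).
Definition e_r (R : realType) : R * R := (0, 1).
Arguments e_theta {R}.
Arguments e_r {R}.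

(* [f] is of class C^k on the set [U], which is meant to be open: the values of
   [f] outside [U] are then irrelevant. *)
Fixpoint Ck_on (R : realType) (U : set (R * R)) (k : nat) (f : R * R -> R) :
    Prop :=
  (forall z, U z -> {for z, continuous f}) /\
  if k is k'.+1 then
    [/\ forall z, U z -> derivable f z e_theta,
        forall z, U z -> derivable f z e_r,
        Ck_on U k' (fun z => 'D_e_theta f z) &
        Ck_on U k' (fun z => 'D_e_r f z)]
  else True.

Definition C1_closure (R : realType) (D : set (R * R)) (f : R * R -> R) :
    Prop :=
  exists U : set (R * R), [/\ open U, closure D `<=` U & Ck_on U 1 f].

(* C_c^oo(D), functions being extended by 0 to the whole plane *)
Definition test_function (R : realType) (D : set (R * R)) (phi : R * R -> R) :
    Prop :=
  (forall k, Ck_on setT k phi) /\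
  exists K : set (R * R),
    [/\ compact K, K `<=` D & forall z, ~ K z -> phi z = 0].

Definition L2 (d : measure_display) (T : measurableType d) (R : realType)
    (mu : {measure set T -> \bar R}) (D : set T) (f : T -> R) : Prop :=
  measurable_fun D f /\ (\int[mu]_(x in D) ((f x) ^+ 2)%:E < +oo)%E.

Definition L2_cvg (d : measure_display) (T : measurableType d) (R : realType)
    (mu : {measure set T -> \bar R}) (D : set T) (f_ : nat -> T -> R)
    (f : T -> R) : Prop :=
  (\int[mu]_(x in D) ((f_ n x - f x) ^+ 2)%:E)%E @[n --> \oo] --> 0%E.

Definition weak_derivative (R : realType) (D : set (R * R)) (v : R * R)
    (u g : R * R -> R) : Prop :=
  forall phi, test_function D phi ->
  (\int[leb2 R]_(z in D) (u z * 'D_v phi z)%:E =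
   - \int[leb2 R]_(z in D) (g z * phi z)%:E)%E.

(* An element of H^1(D) comes with representatives of its weak derivatives,
   which are unique up to a null set. *)
Record H1 (R : realType) (D : set (R * R)) := MkH1 {
  H1_fun :> R * R -> R;
  H1_dtheta : R * R -> R;
  H1_dr : R * R -> R;
  H1_L2 : L2 (leb2 R) D H1_fun;
  H1_dtheta_L2 : L2 (leb2 R) D H1_dtheta;
  H1_dr_L2 : L2 (leb2 R) D H1_dr;
  H1_dthetaP : weak_derivative D e_theta H1_fun H1_dtheta;
  H1_drP : weak_derivative D e_r H1_fun H1_dr
}.

Definition H1_cvg (R : realType) (D : set (R * R)) (phi : nat -> R * R -> R)
    (u : H1 D) : Prop :=
  [/\ L2_cvg (leb2 R) D phi u,
      L2_cvg (leb2 R) D (fun n z => 'D_e_theta (phi n) z) (H1_dtheta u) &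
      L2_cvg (leb2 R) D (fun n z => 'D_e_r (phi n) z) (H1_dr u)].

Definition Omega (R : realType) (delta : R) : set (R * R) :=
  `]0, 1[ `*` `]delta, 1[.

(* The trace operator on the side r = 1 is the continuous extension to
   H^1(Omega_delta) of the restriction map phi |-> phi(., 1), defined on the
   dense subspace of functions that are C^1 up to the boundary:
   [g] is the trace of [u]. *)
Definition is_trace_top (R : realType) (delta : R) (u : H1 (Omega delta))
    (g : R -> R) : Prop :=
  L2 (leb1 R) `]0, 1[ g /\
  exists phi : nat -> R * R -> R,
    [/\ forall n, C1_closure (Omega delta) (phi n),
        H1_cvg phi u &
        L2_cvg (leb1 R) `]0, 1[ (fun n theta => phi n (theta, 1)) g].

Definition crit_constants (R : realType) (delta : R) : set R :=
  [set C | forall u : H1 (Omega delta), is_trace_top u (fun=> 0) ->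
    (\int[leb2 R]_(z in Omega delta) ((u z) ^+ 2 / z.2)%:E <=
     C%:E * \int[leb2 R]_(z in Omega delta) (z.2 * (H1_dr u z) ^+ 2)%:E)%E].

Definition is_best_constant (R : realType) (delta C : R) : Prop :=
  crit_constants delta C /\ lbound (crit_constants delta) C.

Definition C_crit (R : realType) (delta : R) : R := inf (crit_constants delta).

(* Main.v *)
Require Import Defs.
From HB Require Import structures.
From mathcomp Require Import all_boot all_order all_algebra.
From mathcomp Require Import all_classical all_reals all_analysis.
From mathcomp Require Import measurable_realfun.
From mathcomp Require Import ring lra.

Set Implicit Arguments.
Unset Strict Implicit.
Unset Printing Implicit Defensive.

Import Order.TTheory GRing.Theory Num.Theory.
Import numFieldNormedType.Exports.

Local Open Scope classical_set_scope.
Local Open Scope ring_scope.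

(** Only the variable [r] matters. Write [L = - ln delta]; in the variable
[s = ln r], running over [[-L, 0]], the two integrals are those of [w ^+ 2] and
of the square of the derivative of [w]. So the constant is the inverse of the
lowest eigenvalue of minus the second derivative on an interval of length [L],
with a Dirichlet condition at the end [r = 1] and a free end at [r = delta]:
the eigenfunction is [sin (k0 * s)] with [k0 = pi / (2 * L)], and
[k0 ^- 2 = 4 / pi ^+ 2 * L ^+ 2].

Upper bound. The trace of [u] vanishes only in the limit along a sequence of
[C^1] functions, so an inequality is needed that tolerates a nonzero value at
[r = 1]. For [k < k0], [tan (k * (s + L))] is bounded on [[-L, 0]], and
integrating the square [r * (w' + k * tan (k * (ln r + L)) * w / r) ^+ 2]
gives ([hardy_segment])
  [k ^+ 2 * \int w ^+ 2 / r <= \int r * w' ^+ 2 + k * tan (k * L) * w 1 ^+ 2].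
The last term, finite because [k < k0], tends to [0] once integrated in
[theta] along the sequence that defines the trace. The limit is taken with
[weighted_integral_sqr_le], at the cost of factors [1 + eta]; then [eta]
tends to [0] while [k] tends to [k0] ([hardy_H1]).

Lower bound. [extremal] is [sin (k0 * ln r)]; it is smooth up to the boundary
and vanishes at [r = 1], and its two integrals are computed by the fundamental
theorem of calculus ([integral_extremal], [integral_dr_extremal]). That a
function which is [C^1] up to the boundary defines an element of [H1], with
its classical derivatives as weak derivatives and its restriction as trace, is
proved in [H1_of_C1] and [is_trace_top_C1] by integration by parts. *)

(** * Measurability of continuous functions of two variables *)

(** The product sigma-algebra is generated by measurable rectangles, so an open
set has to be written as a countable union of rectangles: those with rational
centre and rational radius that it contains. *)
Lemma open_measurable_prod (R : realType) (U : set (R * R)) :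
  open U -> measurable (U : set (measurableTypeR R * measurableTypeR R)).
Proof.
move=> oU.
pose V (p : rat * rat * rat) : set (measurableTypeR R * measurableTypeR R) :=
  ball (ratr p.1.1 : R) (ratr p.2) `*` ball (ratr p.1.2 : R) (ratr p.2).
pose W p := if `[< V p `<=` U >] then V p else set0.
have -> : U = \bigcup_p W p.
  apply/seteqP; split => [z Uz|z [p _]]; last first.
    by rewrite /W; case: asboolP => [VU /VU//|_ []].
  (* The rational radius is below e / 2, so that the ball about a rational
     point within that radius of z stays in the ball of radius e about z. *)
  have /nbhs_ballP[e /= e0 zeU] : nbhs z U by exact: open_nbhs_nbhs.
  have [q /[!in_itv]/= /andP[q0 qe]] := rat_in_itvoo (divr_gt0 e0 (ltr0n R 2)).
  have [a aq] : exists a : rat, ball z.1 (ratr q) (ratr a : R).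
    have [a /[!in_itv]/= /andP[za az]] : exists a, ratr a \in `]z.1, z.1 + ratr q[.
      by apply: rat_in_itvoo; rewrite ltrDl.
    by exists a; rewrite /ball/= ltr0_norm; lra.
  have [b bq] : exists b : rat, ball z.2 (ratr q) (ratr b : R).
    have [b /[!in_itv]/= /andP[zb bz]] : exists b, ratr b \in `]z.2, z.2 + ratr q[.
      by apply: rat_in_itvoo; rewrite ltrDl.
    by exists b; rewrite /ball/= ltr0_norm; lra.
  exists ((a, b), q) => //; rewrite /W; case: asboolP => [_|[]].
    by split; apply: ball_sym.
  by move=> y [/= y1 y2]; apply: zeU; split => /=; rewrite (splitr e);
    [apply: (@ball_triangle R R (ratr a))|apply: (@ball_triangle R R (ratr b))];
    apply: (le_ball (ltW qe))=> //.
rewrite -[X in measurable X]/(\bigcup_p W p).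
apply: countable_bigcupT_measurable => [|p]; first exact: countableP.
rewrite /W; case: ifPn => // _.
by apply: measurableX; rewrite ball_itv.
Qed.

Lemma continuous_measurable_prod (R : realType) (D : set (R * R))
    (f : R * R -> R) : open D -> (forall z, D z -> {for z, continuous f}) ->
  measurable_fun (D : set (measurableTypeR R * measurableTypeR R)) f.
Proof.
move=> oD cf mD.
apply: (measurability _ (measurable_realfun.RGenOInfty.measurableE R)) => //.
move=> _ [_ [a ->] <-]; apply: open_measurable_prod.
rewrite openE => z [Dz faz]; apply: filterI; first exact: open_nbhs_nbhs.
apply: (cf z Dz); apply: open_nbhs_nbhs; split => //; exact: interval_open.
Qed.

(** * Integration over rectangles and segments *)

Section rectangle.
Variable R : realType.
Local Notation RR := (measurableTypeR R * measurableTypeR R)%type.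
Implicit Types (A B : set R) (f : RR -> \bar R).

Lemma integral_rect_xsection A B f x :
  (\int[leb1 R]_y (f \_ (A `*` B)) (x, y) =
   ((fun x => \int[leb1 R]_(y in B) f (x, y)) \_ A) x)%E.
Proof.
rewrite patchE; case: ifPn => xA.
  rewrite [RHS]integral_mkcond; apply: eq_integral => y _.
  rewrite !patchE; congr (if _ then _ else _).
  by rewrite in_setX xA.
rewrite integral0_eq// => y _; rewrite patchE ifF//.
by rewrite in_setX (negbTE xA).
Qed.

Lemma integral_rect_ysection A B f y :
  (\int[leb1 R]_x (f \_ (A `*` B)) (x, y) =
   ((fun y => \int[leb1 R]_(x in A) f (x, y)) \_ B) y)%E.
Proof.
rewrite patchE; case: ifPn => yB.
  rewrite [RHS]integral_mkcond; apply: eq_integral => x _.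
  rewrite !patchE; congr (if _ then _ else _).
  by rewrite in_setX yB andbT.
rewrite integral0_eq// => x _; rewrite patchE ifF//.
by rewrite in_setX (negbTE yB) andbF.
Qed.

Lemma tonelli_rect A B f : measurable (A : set (measurableTypeR R)) ->
    measurable (B : set (measurableTypeR R)) ->
    measurable_fun (A `*` B : set RR) f ->
    (forall z, (A `*` B) z -> (0 <= f z)%E) ->
  (\int[leb2 R]_(z in A `*` B) f z =
   \int[leb1 R]_(x in A) \int[leb1 R]_(y in B) f (x, y))%E.
Proof.
move=> mA mB mf f0; rewrite integral_mkcond /leb2 fubini_tonelli1.
- rewrite [RHS]integral_mkcond; apply: eq_integral => x _.
  by rewrite -integral_rect_xsection.
- by apply/(measurable_restrictT _ (measurableX mA mB)).
- by move=> z; apply: erestrict_ge0.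
Qed.

(** Both orders of integration are given: the divergence lemmas below integrate
first along the direction of the derivative. *)
Lemma fubini_rect A B f : measurable (A : set (measurableTypeR R)) ->
    measurable (B : set (measurableTypeR R)) ->
    (leb2 R).-integrable (A `*` B) f ->
  (\int[leb2 R]_(z in A `*` B) f z =
     \int[leb1 R]_(x in A) \int[leb1 R]_(y in B) f (x, y))%E /\
  (\int[leb2 R]_(z in A `*` B) f z =
     \int[leb1 R]_(y in B) \int[leb1 R]_(x in A) f (x, y))%E.
Proof.
move=> mA mB intf.
have {}intf : (leb2 R).-integrable setT (f \_ (A `*` B)).
  by apply/(integrable_mkcond _ (measurableX mA mB)).
rewrite integral_mkcond; split.
  rewrite -(integral12_prod_meas1 intf) [RHS]integral_mkcond.
  by apply: eq_integral => x _; rewrite -integral_rect_xsection.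
rewrite -(integral21_prod_meas1 intf) [RHS]integral_mkcond.
by apply: eq_integral => y _; rewrite -integral_rect_ysection.
Qed.

Lemma continuous_xsection (f : R * R -> R) x y :
  {for (x, y), continuous f} -> {for x, continuous (fun t => f (t, y))}.
Proof.
move=> cf; apply: (cvg_comp (fun t => (t, y)) f _ cf).
exact: (@cvg_pair _ _ _ _ _ _ _ _ _ id (fun=> y) cvg_id (cvg_cst y)).
Qed.

Lemma continuous_ysection (f : R * R -> R) x y :
  {for (x, y), continuous f} -> {for y, continuous (fun t => f (x, t))}.
Proof.
move=> cf; apply: (cvg_comp (fun t => (x, t)) f _ cf).
exact: (@cvg_pair _ _ _ _ _ _ _ _ _ (fun=> x) id (cvg_cst x) cvg_id).
Qed.

Lemma continuous_itv_integrable (f : R -> R) a b :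
  (forall x, a <= x <= b -> {for x, continuous f}) ->
  (leb1 R).-integrable `]a, b[ (EFin \o f).
Proof.
move=> cf; apply: (@integrableS _ (measurableTypeR R) R (leb1 R) `[a, b]%classic) => //.
  by apply: subset_itv_oo_cc.
apply: continuous_compact_integrable; first exact: segment_compact.
by apply: continuous_in_subspaceT => x; rewrite inE/= in_itv/=; exact: cf.
Qed.

Lemma open_rect (a b c d : R) : open (`]a, b[ `*` `]c, d[ : set (R * R)).
Proof.
rewrite openE => z [z1 z2]; exists (`]a, b[, `]c, d[)%classic => //.
by split; apply: open_nbhs_nbhs; split=> //; exact: interval_open.
Qed.

Lemma continuous_rect_integrable (f : R * R -> R) a b c d :
  (forall x y, a <= x <= b -> c <= y <= d -> {for (x, y), continuous f}) ->
  (leb2 R).-integrable (`]a, b[ `*` `]c, d[) (EFin \o f).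
Proof.
move=> cf; apply: measurable_bounded_integrable.
- exact: measurableX.
- rewrite [X in (X < _)%E](product_measure1E lebesgue_measure
    lebesgue_measure (measurable_itv _) (measurable_itv _)).
  have fin (s t : R) : lebesgue_measure (`]s, t[%classic : set R) \is a fin_num.
    by rewrite lebesgue_measure_itv/=; case: ifP => _; rewrite -?EFinB.
  by rewrite ltey_eq fin_numM//; exact: fin.
- apply: continuous_measurable_prod.
    exact: open_rect.
  move=> [x y] [/=]; rewrite !in_itv/= => /andP[/ltW ax /ltW xb].
  by move=> /andP[/ltW cy /ltW yd]; apply: cf; apply/andP.
- have cK : compact (`[a, b] `*` `[c, d] : set (R * R)).
    by apply: compact_setX; exact: segment_compact.
  have wf : {within `[a, b] `*` `[c, d], continuous f}.
    apply: continuous_in_subspaceT => -[x y]; rewrite inE => -[/=].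
    by rewrite !in_itv/=; exact: cf.
  have [M [Mr HM]] := compact_bounded (continuous_compact wf cK).
  exists M; split => // N MN z [/= z1 z2]; apply: HM => //.
  by exists z => //; split => /=; apply: subset_itv_oo_cc.
Qed.

(** The hypotheses hold up to and including the end points, as they do for
functions that are smooth on a neighbourhood of the closed segment; this avoids
one-sided limits. *)
Lemma FTC2_itvoo (F f : R -> R) (a b : R) : a < b ->
  (forall x, a <= x <= b -> is_derive x 1 F (f x)) ->
  (forall x, a <= x <= b -> {for x, continuous f}) ->
  (\int[leb1 R]_(x in `]a, b[) (f x)%:E = (F b - F a)%:E)%E.
Proof.
move=> ab dF cf; rewrite -(@integral_itv_bndoo _ _ _ _ true false); last first.
  by have /integrableP[] := continuous_itv_integrable cf.
have cF x : a <= x <= b -> {for x, continuous F}.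
  by move=> /dF[dFx _]; apply/differentiable_continuous/derivable1_diffP.
rewrite (@continuous_FTC2 _ f F)//.
- by apply: continuous_in_subspaceT => x; rewrite inE/= in_itv/=; exact: cf.
- split.
  + move=> x /[!in_itv]/= /andP[/ltW ax /ltW xb].
    by have [] : is_derive x 1 F (f x) by apply: dF; apply/andP.
  + by apply: cvg_at_right_filter; apply: cF; rewrite lexx ltW.
  + by apply: cvg_at_left_filter; apply: cF; rewrite lexx ltW.
- move=> x /[!in_itv]/= /andP[/ltW ax /ltW xb]; rewrite derive1E.
  by apply: derive_val; apply: dF; apply/andP.
Qed.

End rectangle.

Lemma measurable_integral_rect (R : realType) (A B : set R)
    (f : measurableTypeR R * measurableTypeR R -> \bar R) :
    measurable (A : set (measurableTypeR R)) ->
    measurable (B : set (measurableTypeR R)) ->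
    measurable_fun (A `*` B : set (measurableTypeR R * measurableTypeR R)) f ->
    (forall z, (A `*` B) z -> (0 <= f z)%E) ->
  measurable_fun (A : set (measurableTypeR R))
    (fun x => \int[leb1 R]_(y in B) f (x, y))%E.
Proof.
move=> mA mB mf f0; apply/(measurable_restrictT _ mA).
have -> : (fun x => \int[leb1 R]_(y in B) f (x, y))%E \_ A =
    fubini_F (leb1 R) (f \_ (A `*` B)).
  by apply/funext => x; rewrite -integral_rect_xsection.
apply: (@measurable_fun_fubini_tonelli_F _ _ _ _ R lebesgue_measure).
  by apply/(measurable_restrictT _ (measurableX mA mB)).
by move=> z; apply: erestrict_ge0.
Qed.

(** * Closed rectangles and partial derivatives *)

(** The left end is approached from the right, every other point from the
left. *)
Lemma itvcc_sub_closure (R : realType) (a b : R) : a < b ->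
  `[a, b] `<=` closure `]a, b[.
Proof.
move=> ab x; rewrite /= in_itv/= => /andP[ax xb] B Bx.
move: ax; rewrite le_eqVlt => /predU1P[ax|ax].
  subst x.
  have [y] : exists y, (`]a, b[ `&` B) y.
    apply: (@filter_ex _ (a^'+)); near=> y; split; last first.
    by near: y; exact: cvg_within.
    by rewrite /= in_itv/=; apply/andP; split.
  by exists y.
have [y] : exists y, (`]a, b[ `&` B) y.
  apply: (@filter_ex _ (x^'-)); near=> y; split; last first.
    by near: y; exact: cvg_within.
  rewrite /= in_itv/=; apply/andP; split => //.
  by apply: lt_le_trans xb.
by exists y.
Unshelve. all: by end_near. Qed.

Lemma closed_rect_sub_closure (R : realType) (delta : R) : delta < 1 ->
  `[0, 1] `*` `[delta, 1] `<=` closure (Omega delta).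
Proof.
move=> d1 [x y] [/= xI yI] B [[P Q]/= [Px Qy] PQB].
have [s [sI Ps]] := itvcc_sub_closure ltr01 xI Px.
have [t [tI Qt]] := itvcc_sub_closure d1 yI Qy.
by exists (s, t); split => //; apply: PQB.
Qed.

Lemma is_derive_e_theta (R : realType) (f : R * R -> R) x y d :
  is_derive (x, y) e_theta f d <-> is_derive x 1 (fun t => f (t, y)) d.
Proof.
have E : (fun h : R => h^-1 *: ((f \o shift (x, y)) (h *: e_theta) - f (x, y))) =
   (fun h : R => h^-1 *: (((fun t => f (t, y)) \o shift x) (h *: (1:R)) - f (x, y))).
  apply/funext => h /=; congr (_ *: (f _ - _)).
  rewrite /shift/= (_ : _ + _ = (h * 1 + x, h * 0 + y))//.
  by rewrite mulr0 add0r.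
by split=> -[]; rewrite /derivable /derive => dv dd; apply: DeriveDef;
  move: dv dd; rewrite /derivable /derive E.
Qed.

Lemma is_derive_e_r (R : realType) (f : R * R -> R) x y d :
  is_derive (x, y) e_r f d <-> is_derive y 1 (fun t => f (x, t)) d.
Proof.
have E : (fun h : R => h^-1 *: ((f \o shift (x, y)) (h *: e_r) - f (x, y))) =
   (fun h : R => h^-1 *: (((fun t => f (x, t)) \o shift y) (h *: (1:R)) - f (x, y))).
  apply/funext => h /=; congr (_ *: (f _ - _)).
  rewrite /shift/= (_ : _ + _ = (h * 0 + x, h * 1 + y))//.
  by rewrite mulr0 add0r.
by split=> -[]; rewrite /derivable /derive => dv dd; apply: DeriveDef;
  move: dv dd; rewrite /derivable /derive E.
Qed.

(** * The inequality on a segment, with a boundary term *)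

(** With [q = k * tan (k * (ln r - ln delta))] one has
[r * (w' + q * w / r) ^+ 2 =
 r * w' ^+ 2 + (q * w ^+ 2)' - k ^+ 2 * w ^+ 2 / r],
because [r * q' = k ^+ 2 + q ^+ 2]. The function [q] vanishes at [delta], and
[k * - ln delta < pi / 2] keeps it finite up to [r = 1]; hence the only
boundary term is the one at [1]. *)
Lemma hardy_segment (R : realType) (delta k : R) (w w' : R -> R) :
  0 < delta < 1 -> 0 <= k -> k * - ln delta < pi / 2 ->
  (forall r, delta <= r <= 1 -> is_derive r 1 w (w' r)) ->
  (forall r, delta <= r <= 1 -> {for r, continuous w'}) ->
  ((k ^+ 2)%:E * \int[leb1 R]_(r in `]delta, 1%R[) (w r ^+ 2 / r)%:E <=
   \int[leb1 R]_(r in `]delta, 1%R[) (r * w' r ^+ 2)%:E +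
   (k * tan (k * - ln delta) * w 1 ^+ 2)%:E)%E.
Proof.
move=> /andP[d0 d1] k0 kpi dw cw'.
pose p r := k * (ln r - ln delta).
pose T r := tan (p r).
pose G r := k * T r * w r ^+ 2.
pose G' r := (k ^+ 2 * (1 + T r ^+ 2) / r) * w r ^+ 2 + 2 * k * T r * w r * w' r.
have r_gt0 r : delta <= r <= 1 -> 0 < r by move=> /andP[/(lt_le_trans d0)].
have cosp r : delta <= r <= 1 -> cos (p r) != 0.
  move=> r01; have r0 := r_gt0 _ r01; have /andP[dr r1] := r01.
  rewrite gt_eqF// cos_gt0_pihalf//.
  have : ln delta <= ln r by rewrite ler_ln.
  have := ln_le0 r1.
  have := pi_gt0 R.
  move=> pi0 lnr ldr; rewrite /p; apply/andP; split.
    by apply: lt_le_trans (_ : 0 <= _); [lra|apply: mulr_ge0; lra].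
  apply: le_lt_trans kpi; apply: ler_wpM2l => //; lra.
have dp r : delta <= r <= 1 -> is_derive r 1 p (k / r).
  move=> /r_gt0 r0; have ? := is_derive1_ln r0.
  apply: is_derive_eq; rewrite /GRing.scale/=. by rewrite subr0.
have dT r : delta <= r <= 1 -> is_derive r 1 T (k * (1 + T r ^+ 2) / r).
  move=> r01; have ? := dp _ r01; have ? := is_derive_tan (cosp _ r01).
  by rewrite -cos2_tan2 ?cosp// mulrAC mulrC; exact: is_derive1_comp.
have dG r : delta <= r <= 1 -> is_derive r 1 G (G' r).
  move=> r01; have ? := dT _ r01; have ? := dw _ r01.
  apply: is_derive_eq; rewrite /G' /GRing.scale/=.
  by field; rewrite gt_eqF// r_gt0.
have cT r : delta <= r <= 1 -> {for r, continuous T}.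
  by move=> /dT[dTr _]; apply/differentiable_continuous/derivable1_diffP.
have cw r : delta <= r <= 1 -> {for r, continuous w}.
  by move=> /dw[dwr _]; apply/differentiable_continuous/derivable1_diffP.
have cV r : delta <= r <= 1 -> {for r, continuous (fun x : R => x^-1)}.
  by move=> /r_gt0 r0; apply: inv_continuous; rewrite gt_eqF.
have cG' r : delta <= r <= 1 -> {for r, continuous G'}.
  move=> r01; have := cV _ r01; have := cT _ r01.
  have := cw _ r01; have := cw' _ r01 => ? ? ? ?.
  have cc (x : R) : {for r, continuous (fun=> x : R)}.
    exact: cst_continuous.
  apply: continuousD.
    apply: continuousM; last by apply: continuousM.
    apply: continuousM => //; apply: continuousM => //.
    by apply: continuousD => //; apply: continuousM.
  by do 3![apply: continuousM => //].
have c1 r : delta <= r <= 1 -> {for r, continuous (fun r : R => w r ^+ 2 / r)}.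
  move=> r01; have := cV _ r01;  have := cw _ r01.
  by move=> ? ?; repeat (apply: continuousM => //).
have c2 r : delta <= r <= 1 -> {for r, continuous (fun r : R => r * w' r ^+ 2)}.
  move=> r01; have := cw' _ r01.
  by move=> ?; repeat (apply: continuousM => //).
have intG : (\int[leb1 R]_(r in `]delta, 1%R[) (G' r)%:E =
    (k * tan (k * - ln delta) * w 1 ^+ 2)%:E)%E.
  rewrite (FTC2_itvoo d1 dG cG') /G /T /p; congr _%:E.
  by rewrite subrr mulr0 tan0 mulr0 mul0r subr0 ln1 sub0r.
have i1 := continuous_itv_integrable c1.
have i2 := continuous_itv_integrable c2.
have iG := continuous_itv_integrable cG'.
rewrite -intG -integralZl//; last first.
rewrite -integralD//.
apply: le_integral => //.
- exact: integrableZl.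
- exact: integrableD.
move=> r; rewrite inE/= in_itv/= => /andP[/ltW dr /ltW r1].
rewrite -EFinM -EFinD lee_fin.
have r0 : 0 < r by apply: r_gt0; apply/andP.
rewrite -subr_ge0 (_ : _ - _ = r * (w' r + k * T r * w r / r) ^+ 2).
  by rewrite mulr_ge0 ?sqr_ge0// ltW.
by rewrite /G'; field; rewrite gt_eqF.
Qed.

(** * The inequality on the rectangle *)

(** From [f ^+ 2 <= (1 + eta) * g ^+ 2 + (1 + eta^-1) * (f - g) ^+ 2], which
transfers inequalities between weighted square integrals to [L^2] limits
without the triangle inequality for the norm. *)
Lemma weighted_integral_sqr_le (d : measure_display) (T : measurableType d)
    (R : realType) (mu : {measure set T -> \bar R}) (D : set T)
    (f g omega : T -> R) (M eta : R) :
  measurable D -> measurable_fun D f -> measurable_fun D g ->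
  measurable_fun D omega -> (forall x, D x -> 0 <= omega x <= M) ->
  0 <= M -> 0 < eta ->
  (\int[mu]_(x in D) (f x ^+ 2 * omega x)%:E <=
   (1 + eta)%:E * \int[mu]_(x in D) (g x ^+ 2 * omega x)%:E +
   ((1 + eta^-1) * M)%:E * \int[mu]_(x in D) ((f x - g x) ^+ 2)%:E)%E.
Proof.
move=> mD mf mg mw w0M M0 eta0.
have eta1 : 0 < eta^-1 by rewrite invr_gt0.
have mgw : measurable_fun D (fun x => (g x ^+ 2 * omega x)%:E).
  by apply/measurable_EFinP; apply: measurable_funM => //; apply: measurable_funX.
have mfg : measurable_fun D (fun x => ((f x - g x) ^+ 2)%:E).
  by apply/measurable_EFinP; apply: measurable_funX; apply: measurable_funB.
have gw0 x : D x -> (0 <= (g x ^+ 2 * omega x)%:E)%E.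
  by move=> /w0M/andP[w0 _]; rewrite lee_fin mulr_ge0// sqr_ge0.
have fg0 x : D x -> (0 <= ((f x - g x) ^+ 2)%:E)%E by rewrite lee_fin sqr_ge0.
have c0 : 0 <= 1 + eta by lra.
have cM0 : 0 <= (1 + eta^-1) * M by rewrite mulr_ge0//; lra.
rewrite -!ge0_integralZl_EFin// -ge0_integralD//.
- apply: ge0_le_integral => //.
  + by move=> x /w0M/andP[w0 _]; rewrite lee_fin mulr_ge0// sqr_ge0.
  + by apply/measurable_EFinP; apply: measurable_funM => //; apply: measurable_funX.
  + by apply: emeasurable_funD; apply: measurable_funeM.
  + move=> x /w0M/andP[w0 wM]; rewrite -!EFinM -EFinD lee_fin.
    rewrite [leRHS]addrC -lerBlDr.
    (* Completing the square; the negative square is then dropped. *)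
    have -> : f x ^+ 2 * omega x - (1 + eta) * (g x ^+ 2 * omega x) =
       ((1 + eta^-1) * (f x - g x) ^+ 2 -
        eta^-1 * (f x - g x - eta * g x)^+2) * omega x.
      by field; rewrite gt_eqF.
    apply: (@le_trans _ _ (((1 + eta^-1) * (f x - g x) ^+ 2) * omega x)).
      apply: ler_wpM2r => //; rewrite gerBl mulr_ge0 ?sqr_ge0//; exact: ltW.
    rewrite -[leLHS]mulrA -[leRHS]mulrA; apply: ler_wpM2l; first lra.
    by rewrite mulrC; apply: ler_wpM2r => //; rewrite sqr_ge0.
- by move=> x /gw0 h; rewrite mule_ge0.
- by apply: measurable_funeM.
- by move=> x /fg0 h; rewrite mule_ge0.
- by apply: measurable_funeM.
Qed.

Lemma tan_ge0 (R : realType) (x : R) : 0 <= x < pi / 2 -> 0 <= tan x.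
Proof.
have := pi_gt0 R => pi0 /andP[x0 xpi]; rewrite /tan divr_ge0//.
  by apply: sin_ge0_pi; lra.
by apply/ltW/cos_gt0_pihalf; lra.
Qed.

Section hardy_Omega.
Variable R : realType.
Local Notation RR := (measurableTypeR R * measurableTypeR R)%type.
Variable delta : R.
Hypothesis delta01 : 0 < delta < 1.

Let d0 : 0 < delta. Proof. by case/andP: delta01. Qed.
Let d1 : delta < 1. Proof. by case/andP: delta01. Qed.

Lemma measurable_Omega : measurable (Omega delta : set RR).
Proof. exact: measurableX. Qed.

Lemma Omega_snd (z : R * R) : Omega delta z -> delta < z.2 < 1.
Proof. by case=> _; rewrite /= in_itv. Qed.

Lemma measurable_snd_Omega : measurable_fun (Omega delta : set RR) (snd : RR -> R).
Proof. exact: measurable_funTS. Qed.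

Lemma measurable_invr_snd_Omega :
  measurable_fun (Omega delta : set RR) (fun z : RR => (z.2 : R)^-1).
Proof.
apply: continuous_measurable_prod; first exact: open_rect.
move=> [x y] /Omega_snd/= /andP[dy _].
apply: (@continuousV _ _ (snd : R * R -> R)); last exact: cvg_snd.
by rewrite gt_eqF//= (lt_trans d0).
Qed.

Lemma C1_closure_rect (f : R * R -> R) : C1_closure (Omega delta) f ->
  forall z, (`[0, 1] `*` `[delta, 1]) z ->
  [/\ {for z, continuous f}, derivable f z e_theta, derivable f z e_r,
      {for z, continuous (fun z => 'D_e_theta f z)} &
      {for z, continuous (fun z => 'D_e_r f z)}].
Proof.
move=> [U [oU sU [cf [dt dr [ct _] [cr _]]]]] z zK.
have Uz : U z by apply/sU/closed_rect_sub_closure.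
by split; [exact: cf|exact: dt|exact: dr|exact: ct|exact: cr].
Qed.

Lemma Omega_sub_rect : Omega delta `<=` `[0, 1] `*` `[delta, 1].
Proof. by move=> z [z1 z2]; split; apply: subset_itv_oo_cc. Qed.

Lemma measurable_continuous_Omega (f : R * R -> R) :
  (forall z, (`[0, 1] `*` `[delta, 1]) z -> {for z, continuous f}) ->
  measurable_fun (Omega delta : set RR) (f : RR -> R).
Proof.
move=> cf; apply: continuous_measurable_prod; first exact: open_rect.
by move=> z /Omega_sub_rect; exact: cf.
Qed.

Lemma C1_closure_measurable (f : R * R -> R) : C1_closure (Omega delta) f ->
  [/\ measurable_fun (Omega delta : set RR) (f : RR -> R),
      measurable_fun (Omega delta : set RR) (fun z : RR => 'D_e_theta f z) &
      measurable_fun (Omega delta : set RR) (fun z : RR => 'D_e_r f z)].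
Proof.
move=> /C1_closure_rect Cf; split.
- by apply: measurable_continuous_Omega => z /Cf[cf _ _ _ _]; exact: cf.
- apply: (@measurable_continuous_Omega (fun z => 'D_e_theta f z)) => z.
  by move=> /Cf[_ _ _ ct _]; exact: ct.
- apply: (@measurable_continuous_Omega (fun z => 'D_e_r f z)) => z.
  by move=> /Cf[_ _ _ _ cr]; exact: cr.
Qed.

(** [hardy_segment] on every vertical segment, integrated in [theta]; the
boundary term becomes the squared norm of the restriction to the side
[r = 1]. *)
Lemma hardy_Omega_C1 (k : R) (f : R * R -> R) :
  0 <= k -> k * - ln delta < pi / 2 -> C1_closure (Omega delta) f ->
  ((k ^+ 2)%:E * \int[leb2 R]_(z in Omega delta) (f z ^+ 2 / z.2)%:E <=
   \int[leb2 R]_(z in Omega delta) (z.2 * 'D_e_r f z ^+ 2)%:E +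
   (k * tan (k * - ln delta))%:E *
   \int[leb1 R]_(x in `]0%R, 1%R[) (f (x, 1%R) ^+ 2)%:E)%E.
Proof.
move=> k0 kpi Cf; have Cf' := C1_closure_rect Cf.
have [mf _ mfr] := C1_closure_measurable Cf.
have m1 : measurable_fun (Omega delta : set RR)
    (fun z : RR => (f z ^+ 2 / (z.2 : R))%:E).
  apply/measurable_EFinP; apply: measurable_funM; first exact: measurable_funX.
  exact: measurable_invr_snd_Omega.
have m2 : measurable_fun (Omega delta : set RR)
    (fun z : RR => ((z.2 : R) * 'D_e_r f z ^+ 2)%:E).
  apply/measurable_EFinP; apply: measurable_funM; first exact: measurable_snd_Omega.
  exact: measurable_funX.
have p1 z : Omega delta z -> (0 <= (f z ^+ 2 / z.2)%:E)%E.
  move=> /Omega_snd/andP[/(lt_trans d0) z0 _].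
  by rewrite lee_fin divr_ge0 ?sqr_ge0// ltW.
have p2 z : Omega delta z -> (0 <= (z.2 * 'D_e_r f z ^+ 2)%:E)%E.
  move=> /Omega_snd/andP[/(lt_trans d0) z0 _].
  by rewrite lee_fin mulr_ge0 ?sqr_ge0// ltW.
have ktan0 : 0 <= k * tan (k * - ln delta).
  rewrite mulr_ge0// tan_ge0// kpi andbT mulr_ge0// oppr_ge0 ln_le0//.
  exact: ltW.
have mtop : measurable_fun (`]0%R, 1%R[ : set (measurableTypeR R))
    (fun x => (f (x, 1%R) ^+ 2)%:E).
  apply/measurable_EFinP; apply: measurable_funX.
  apply: open_continuous_measurable_fun => // x; rewrite inE/= => x01.
  apply: continuous_xsection.
  have [] // := Cf' (x, 1); split; first exact: subset_itv_oo_cc.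
  by rewrite /= in_itv/= lexx andbT ltW.
rewrite !tonelli_rect//.
have n1 := measurable_integral_rect (measurable_itv _) (measurable_itv _) m1 p1.
have n2 := measurable_integral_rect (measurable_itv _) (measurable_itv _) m2 p2.
have q1 x : `]0, 1[%classic x ->
    (0 <= \int[leb1 R]_(y in `]delta, 1%R[) (f (x, y) ^+ 2 / y)%:E)%E.
  by move=> x01; apply: integral_ge0 => y y01; apply: (p1 (x, y)).
have q2 x : `]0, 1[%classic x ->
    (0 <= \int[leb1 R]_(y in `]delta, 1%R[) (y * 'D_e_r f (x, y) ^+ 2)%:E)%E.
  by move=> x01; apply: integral_ge0 => y y01; apply: (p2 (x, y)).
rewrite -ge0_integralZl_EFin ?sqr_ge0//.
rewrite -ge0_integralZl_EFin//; last by move=> x _; rewrite lee_fin sqr_ge0.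
rewrite -ge0_integralD//; last 2 first.
  by move=> x _; rewrite mule_ge0// lee_fin sqr_ge0.
  by apply: measurable_funeM.
apply: ge0_le_integral => //.
- by move=> x x01; rewrite mule_ge0 ?q1// lee_fin sqr_ge0.
- exact: measurable_funeM.
- by apply: emeasurable_funD => //; exact: measurable_funeM.
move=> x x01; rewrite -EFinM.
have K y : delta <= y <= 1 -> (`[0, 1] `*` `[delta, 1]) (x, y).
  by move=> y01; split; [exact: subset_itv_oo_cc|rewrite /= in_itv].
apply: (@hardy_segment R delta k (fun y => f (x, y))
  (fun y => 'D_e_r f (x, y))) => // y /K/Cf'[].
  by move=> _ _ h _ _; apply/is_derive_e_r/derivableP.
by move=> _ _ _ _ h; exact: (continuous_ysection h).
Qed.

(** Along the sequence that defines the trace, the errors [\int (phi n - u)^2],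
[\int (D_r phi n - D_r u)^2] and [\int phi n (., 1)^2] become arbitrarily
small. They enter the final bound through the single constant [c] of the
proof. *)
Lemma hardy_H1_eta (k eta : R) (u : H1 (Omega delta)) :
  0 <= k -> k * - ln delta < pi / 2 -> 0 < eta ->
  is_trace_top u (fun=> 0) ->
  ((k ^+ 2)%:E * \int[leb2 R]_(z in Omega delta) (u z ^+ 2 / z.2)%:E <=
   ((1 + eta) ^+ 2)%:E *
   \int[leb2 R]_(z in Omega delta) (z.2 * H1_dr u z ^+ 2)%:E)%E.
Proof.
move=> k0 kpi eta0 [_ [phi [phiC1 [cvg_u _ cvg_ur] cvg_trace]]].
set K := k * tan (k * - ln delta).
have K0 : 0 <= K.
  rewrite mulr_ge0// tan_ge0// kpi andbT mulr_ge0// oppr_ge0 ln_le0//.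
  exact: ltW.
pose c := (1 + eta) * ((1 + eta^-1) + K) + k ^+ 2 * ((1 + eta^-1) / delta).
have eta1 : 0 < eta^-1 by rewrite invr_gt0.
have dV0 : 0 < delta^-1 by rewrite invr_gt0.
have c0 : 0 < c.
  apply: ltr_wpDr; first by rewrite mulr_ge0 ?sqr_ge0// mulr_ge0//; lra.
  by apply: mulr_gt0; lra.
apply/lee_addgt0Pr => e e0.
have ec0 : (0 < (e / c)%:E)%E by rewrite lte_fin divr_gt0.
have small (F : nat -> \bar R) : F n @[n --> \oo] --> 0%E ->
    \forall n \near \oo, (F n < (e / c)%:E)%E.
  move=> F0; apply: (F0 [set x | (x < (e / c)%:E)%E]).
  by apply: open_nbhs_nbhs; split; [exact: open_ereal_lt_ereal|].
have [n [/ltW un /ltW urn /ltW tn]] : exists n,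
    [/\ (\int[leb2 R]_(z in Omega delta) ((phi n z - u z) ^+ 2)%:E < (e / c)%:E)%E,
        (\int[leb2 R]_(z in Omega delta) (('D_e_r (phi n) z - H1_dr u z) ^+ 2)%:E
          < (e / c)%:E)%E &
        (\int[leb1 R]_(x in `]0%R, 1%R[) ((phi n (x, 1%R) - 0) ^+ 2)%:E
          < (e / c)%:E)%E].
  near \oo => n; exists n; split; near: n; exact: small.
have [mphi _ mphir] := C1_closure_measurable (phiC1 n).
have [mu _] := H1_L2 u.
have [mur _] := H1_dr_L2 u.
have hu : (\int[leb2 R]_(z in Omega delta) (u z ^+ 2 / z.2)%:E <=
    (1 + eta)%:E * \int[leb2 R]_(z in Omega delta) (phi n z ^+ 2 / z.2)%:E +
    ((1 + eta^-1) / delta)%:E * (e / c)%:E)%E.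
  apply: le_trans (@weighted_integral_sqr_le _ _ _ (leb2 R) _ u (phi n) (fun z => z.2^-1)
    delta^-1 eta measurable_Omega mu mphi measurable_invr_snd_Omega _ (ltW dV0) eta0) _.
    move=> z /Omega_snd/andP[dz _].
    by rewrite invr_ge0 lef_pV2 ?posrE ?ltW// (lt_trans d0).
  apply: leeD => //; apply: lee_wpmul2l; first by rewrite lee_fin mulr_ge0//; lra.
  apply: le_trans un; rewrite le_eqVlt; apply/orP; left; apply/eqP.
  by apply: eq_integral => z _; rewrite -sqrrN opprB.
have hur : (\int[leb2 R]_(z in Omega delta) (z.2 * 'D_e_r (phi n) z ^+ 2)%:E <=
    (1 + eta)%:E * \int[leb2 R]_(z in Omega delta) (z.2 * H1_dr u z ^+ 2)%:E +
    (1 + eta^-1)%:E * (e / c)%:E)%E.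
  have swap (g : R * R -> R) :
      (\int[leb2 R]_(z in Omega delta) (z.2 * g z ^+ 2)%:E =
       \int[leb2 R]_(z in Omega delta) (g z ^+ 2 * z.2)%:E)%E.
    by apply: eq_integral => z _; rewrite mulrC.
  rewrite !swap.
  apply: le_trans (@weighted_integral_sqr_le _ _ _ (leb2 R) _ (fun z => 'D_e_r (phi n) z)
    (H1_dr u) snd 1 eta measurable_Omega mphir mur measurable_snd_Omega _ ler01 eta0) _.
    by move=> z /Omega_snd/andP[dz z1]; rewrite !ltW// (lt_trans d0).
  by rewrite mulr1; apply: leeD => //; apply: lee_wpmul2l => //; rewrite lee_fin; lra.
have hphi := hardy_Omega_C1 k0 kpi (phiC1 n).
have {}tn : (\int[leb1 R]_(x in `]0%R, 1%R[) (phi n (x, 1%R) ^+ 2)%:E <=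
    (e / c)%:E)%E.
  apply: le_trans tn; rewrite le_eqVlt; apply/orP; left; apply/eqP.
  by apply: eq_integral => x _; rewrite subr0.
have X0 : (0 <= \int[leb2 R]_(z in Omega delta) (phi n z ^+ 2 / z.2)%:E)%E.
  apply: integral_ge0 => z /Omega_snd/andP[/(lt_trans d0) z0 _].
  by rewrite lee_fin divr_ge0 ?sqr_ge0// ltW.
have B0 : (0 <= \int[leb2 R]_(z in Omega delta) (z.2 * H1_dr u z ^+ 2)%:E)%E.
  apply: integral_ge0 => z /Omega_snd/andP[/(lt_trans d0) z0 _].
  by rewrite lee_fin mulr_ge0 ?sqr_ge0// ltW.
move: hu hur hphi tn X0 B0.
move: (integral _ _ _) => A; move: (integral _ _ _) => X.
move: (integral _ _ _) => Y; move: (integral _ _ _) => B.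
move: (integral _ _ _) => t.
move=> hu hur hphi tn X0 B0.
have c10 : 0 <= (1 + eta^-1) / delta by rewrite mulr_ge0 ?ltW//; lra.
apply: le_trans (lee_wpmul2l _ hu) _; first by rewrite lee_fin sqr_ge0.
rewrite ge0_muleDr; last 2 first.
- by rewrite mule_ge0// lee_fin; lra.
- by rewrite -EFinM lee_fin mulr_ge0// ltW// divr_gt0.
rewrite muleCA.
have {}hphi : ((k ^+ 2)%:E * X <= (1 + eta)%:E * B + (1 + eta^-1)%:E * (e / c)%:E
    + K%:E * (e / c)%:E)%E.
  by apply: le_trans hphi _; apply: leeD => //; apply: lee_wpmul2l.
apply: le_trans (leeD (lee_wpmul2l _ hphi) (lexx _)) _.
  by rewrite lee_fin; lra.
move: B0; case: B {hphi hur} => [b|_|//].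
  rewrite lee_fin => b0; rewrite -!(EFinM, EFinD) lee_fin.
  rewrite le_eqVlt; apply/orP; left; apply/eqP.
  rewrite [in RHS](_ : e = c * (e / c)); last by rewrite mulrC divfK ?gt_eqF.
  by move: (e / c) => e'; rewrite /c; ring.
by rewrite [leRHS](_ : _ = +oo%E) ?leey// gt0_muley// lte_fin exprn_gt0//; lra.
Unshelve. all: by end_near. Qed.

(** Take [k = k0 / (1 + eta)] in [hardy_H1_eta] and let [eta] tend to [0]. *)
Lemma hardy_H1 (u : H1 (Omega delta)) : is_trace_top u (fun=> 0) ->
  (\int[leb2 R]_(z in Omega delta) (u z ^+ 2 / z.2)%:E <=
   (4 / pi ^+ 2 * `|ln delta| ^+ 2)%:E *
   \int[leb2 R]_(z in Omega delta) (z.2 * H1_dr u z ^+ 2)%:E)%E.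
Proof.
move=> u0; have pi0 := pi_gt0 R.
have lnd : ln delta < 0 by exact: ln_lt0.
rewrite (ltr0_norm lnd).
pose L := - ln delta; have L0 : 0 < L by rewrite oppr_gt0.
pose k0 := pi / (2 * L); have k00 : 0 < k0 by rewrite divr_gt0// mulr_gt0.
have H eta : 0 < eta ->
  (((k0 / (1 + eta)) ^+ 2)%:E * \int[leb2 R]_(z in Omega delta) (u z ^+ 2 / z.2)%:E <=
   ((1 + eta) ^+ 2)%:E *
   \int[leb2 R]_(z in Omega delta) (z.2 * H1_dr u z ^+ 2)%:E)%E.
  move=> eta0; apply: hardy_H1_eta => //.
    by rewrite divr_ge0//; [exact: ltW|lra].
  rewrite (_ : _ * - ln delta = pi / 2 * (1 + eta)^-1).
    by rewrite gtr_pMr ?divr_gt0// invf_lt1; lra.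
  by rewrite /k0 -/L; field; apply/andP; split; rewrite gt_eqF//; lra.
have B0 : (0 <= \int[leb2 R]_(z in Omega delta) (z.2 * H1_dr u z ^+ 2)%:E)%E.
  apply: integral_ge0 => z /Omega_snd/andP[/(lt_trans d0) z0 _].
  by rewrite lee_fin mulr_ge0 ?sqr_ge0// ltW.
have C0 : 0 < 4 / pi ^+ 2 * (- ln delta) ^+ 2.
  by rewrite mulr_gt0 ?exprn_gt0// divr_gt0// exprn_gt0.
move: H B0; move: (integral _ _ _) => A; move: (integral _ _ _) => [b|_ _|//]; last first.
  by rewrite gt0_muley ?leey// lte_fin.
case: A => [a|/(_ 1 ltr01)|]; last 2 first.
- rewrite gt0_muley//; by rewrite lte_fin exprn_gt0// divr_gt0//; lra.
- by move=> _ _; rewrite leNye.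
rewrite lee_fin => H b0; rewrite -EFinM lee_fin.
suff : k0 ^+ 2 * a <= b.
  rewrite -ler_pdivlMl ?exprn_gt0// => /le_trans; apply.
  rewrite le_eqVlt; apply/orP; left; apply/eqP.
  move: pi0; rewrite /k0 -/L; move: (pi : R) => p p0.
  by field; rewrite !gt_eqF.
apply: (introT (ler_addgt0Pr _ _)) => e e0.
pose eta := Num.min 1 (e / (15 * b + 1)).
have b1 : 0 < 15 * b + 1 by lra.
have eta0 : 0 < eta by rewrite lt_min ltr01 divr_gt0.
have eta1 : eta <= 1 by rewrite ge_min lexx.
have etae : 15 * b * eta <= e.
  apply: (@le_trans _ _ (eta * (15 * b + 1))); first by nra.
  by rewrite -ler_pdivlMr// ge_min lexx orbT.
have := H eta eta0; rewrite -!EFinM lee_fin expr_div_n mulrAC ler_pdivrMr; last first.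
  by rewrite exprn_gt0//; lra.
move=> /le_trans; apply.
rewrite mulrAC -exprD /=.
(* The factor (1 + eta) ^+ 4 collects the loss (1 + eta) ^+ 2 of the limit
   and the one from k; the bound uses eta <= 1, and 15 is 2 ^ 4 - 1. *)
have : (1 + eta) ^+ 4 <= 1 + 15 * eta.
  rewrite -subr_ge0.
  have -> : 1 + 15 * eta - (1 + eta) ^+ 4 =
    eta * (1 - eta) * (eta ^+ 2 + 5 * eta + 11) by ring.
  by apply: mulr_ge0; [apply: mulr_ge0; lra|nra].
move=> h; have := ler_wpM2r b0 h; lra.
Qed.

End hardy_Omega.

(** * Functions that are C^1 up to the boundary as elements of H^1 *)

(** In each of the two lemmas the integral along the direction of the derivative
is a difference of boundary values, and these vanish. *)
Section divergence.
Variables (R : realType) (a b c d : R) (F G : R * R -> R).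
Hypotheses (ab : a < b) (cd : c < d).
Let K : set (R * R) := `[a, b] `*` `[c, d].
Hypothesis cG : forall z, K z -> {for z, continuous G}.

Let Kcc x y : a <= x <= b -> c <= y <= d -> K (x, y).
Proof. by move=> ? ?; split; rewrite /= in_itv. Qed.

Let intG := fubini_rect (measurable_itv `]a, b[) (measurable_itv `]c, d[)
  (continuous_rect_integrable (fun x y xab ycd => cG (Kcc xab ycd))).

Lemma integral_dtheta_eq0 :
  (forall z, K z -> is_derive z e_theta F (G z)) ->
  (forall y, c <= y <= d -> F (a, y) = 0 /\ F (b, y) = 0) ->
  (\int[leb2 R]_(z in `]a, b[ `*` `]c, d[) (G z)%:E = 0)%E.
Proof.
move=> dF F0; have [_ ->] := intG.
apply: integral0_eq => y; rewrite /= in_itv/= => /andP[/ltW cy /ltW yd].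
have ycd : c <= y <= d by apply/andP.
have dFy x : a <= x <= b -> is_derive x 1 (fun t => F (t, y)) (G (x, y)).
  by move=> xab; apply/is_derive_e_theta/dF/Kcc.
have cGy x : a <= x <= b -> {for x, continuous (fun t => G (t, y))}.
  by move=> xab; apply/(@continuous_xsection _ _ x y)/cG/Kcc.
by rewrite (FTC2_itvoo ab dFy cGy); have [-> ->] := F0 y ycd; rewrite subrr.
Qed.

Lemma integral_dr_eq0 :
  (forall z, K z -> is_derive z e_r F (G z)) ->
  (forall x, a <= x <= b -> F (x, c) = 0 /\ F (x, d) = 0) ->
  (\int[leb2 R]_(z in `]a, b[ `*` `]c, d[) (G z)%:E = 0)%E.
Proof.
move=> dF F0; have [-> _] := intG.
apply: integral0_eq => x; rewrite /= in_itv/= => /andP[/ltW ax /ltW xb].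
have xab : a <= x <= b by apply/andP.
have dFx y : c <= y <= d -> is_derive y 1 (fun t => F (x, t)) (G (x, y)).
  by move=> ycd; apply/is_derive_e_r/dF/Kcc.
have cGx y : c <= y <= d -> {for y, continuous (fun t => G (x, t))}.
  by move=> ycd; apply/(@continuous_ysection _ _ x y)/cG/Kcc.
by rewrite (FTC2_itvoo cd dFx cGx); have [-> ->] := F0 x xab; rewrite subrr.
Qed.

End divergence.

Section C1_H1.
Variables (R : realType) (delta : R).
Hypothesis delta01 : 0 < delta < 1.
Local Notation K := (`[0, 1] `*` `[delta, 1] : set (R * R)).

Let d1 : delta < 1. Proof. by case/andP: delta01. Qed.

Lemma continuous_rect_Omega_integrable (f : R * R -> R) :
  (forall z, K z -> {for z, continuous f}) ->
  (leb2 R).-integrable (Omega delta) (EFin \o f).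
Proof.
move=> cf; apply: continuous_rect_integrable => x y x01 y01.
by apply: cf; split; rewrite /= in_itv.
Qed.

(** The support is a compact subset of the open rectangle; what is used below is
that [phi] vanishes on the four sides. *)
Lemma test_function_boundary (phi : R * R -> R) (z : R * R) :
  test_function (Omega delta) phi -> ~ Omega delta z -> phi z = 0.
Proof. by move=> [_ [C [_ CO C0]]] zO; apply: C0 => /CO. Qed.

Lemma test_function_C1 (phi : R * R -> R) z : test_function (Omega delta) phi ->
  [/\ {for z, continuous phi}, derivable phi z e_theta, derivable phi z e_r,
      {for z, continuous (fun z => 'D_e_theta phi z)} &
      {for z, continuous (fun z => 'D_e_r phi z)}].
Proof.
move=> [/(_ 1%N)/= [cp [dt dr [ct _] [cr _]]] _].
by split; [exact: cp|exact: dt|exact: dr|exact: ct|exact: cr].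
Qed.

(** When [f] and [phi] are differentiable, the integrand in the last hypothesis
is the derivative of [f * phi] along [v], and its integral a boundary term. *)
Lemma integral_by_parts_weak (v : R * R) (f phi : R * R -> R) :
  (forall z, K z -> {for z, continuous (fun z => f z * 'D_v phi z)}) ->
  (forall z, K z -> {for z, continuous (fun z => 'D_v f z * phi z)}) ->
  (\int[leb2 R]_(z in Omega delta) (f z * 'D_v phi z + 'D_v f z * phi z)%:E = 0)%E ->
  (\int[leb2 R]_(z in Omega delta) (f z * 'D_v phi z)%:E =
   - \int[leb2 R]_(z in Omega delta) ('D_v f z * phi z)%:E)%E.
Proof.
move=> /continuous_rect_Omega_integrable i1 /continuous_rect_Omega_integrable i2.
have mO := measurable_Omega delta.
under eq_integral do rewrite EFinD.
rewrite integralD//.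
have f1 := integrable_fin_num mO i1; have f2 := integrable_fin_num mO i2.
move: f1 f2; case: (integral _ _ _) => // x _; case: (integral _ _ _) => // y _.
by move=> [] /eqP; rewrite addr_eq0 => /eqP ->.
Qed.

Variable f : R * R -> R.
Hypothesis Cf : C1_closure (Omega delta) f.
Let Cf' := C1_closure_rect delta01 Cf.

Lemma weak_derivative_theta_C1 :
  weak_derivative (Omega delta) e_theta f (fun z => 'D_e_theta f z).
Proof.
move=> phi tphi; have Cphi z := test_function_C1 z tphi.
have c1 z : K z -> {for z, continuous (fun z => f z * 'D_e_theta phi z)}.
  case: (Cphi z) => cp _ _ dp _ /Cf'[cf _ _ _ _].
  exact: (continuousM cf dp).
have c2 z : K z -> {for z, continuous (fun z => 'D_e_theta f z * phi z)}.
  case: (Cphi z) => cp _ _ _ _ /Cf'[_ _ _ df _].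
  exact: (continuousM df cp).
apply: integral_by_parts_weak => //.
apply: (@integral_dtheta_eq0 _ _ _ _ _ (f * phi)) => //.
- by move=> z zK; apply: continuousD; [exact: c1|exact: c2].
- move=> z /Cf'[_ df _ _ _]; case: (Cphi z) => _ dphi _ _ _.
  have := derivableP df; have := derivableP dphi => ? ?.
  by apply: is_derive_eq; rewrite /GRing.scale/= [phi z * _]mulrC.
- have vanish z : ~ Omega delta z -> (f * phi) z = 0.
    move=> /(test_function_boundary tphi) p0.
    by rewrite -[LHS]/(f z * phi z) p0 mulr0.
  by move=> y _; split; apply: vanish => -[] /=; rewrite in_itv/= ltxx ?andbF.
Qed.

Lemma weak_derivative_r_C1 : weak_derivative (Omega delta) e_r f (fun z => 'D_e_r f z).
Proof.
move=> phi tphi; have Cphi z := test_function_C1 z tphi.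
have c1 z : K z -> {for z, continuous (fun z => f z * 'D_e_r phi z)}.
  case: (Cphi z) => cp _ _ _ dp /Cf'[cf _ _ _ _].
  exact: (continuousM cf dp).
have c2 z : K z -> {for z, continuous (fun z => 'D_e_r f z * phi z)}.
  case: (Cphi z) => cp _ _ _ _ /Cf'[_ _ _ _ df].
  exact: (continuousM df cp).
apply: integral_by_parts_weak => //.
apply: (@integral_dr_eq0 _ _ _ _ _ (f * phi)) => //.
- by move=> z zK; apply: continuousD; [exact: c1|exact: c2].
- move=> z /Cf'[_ _ df _ _]; case: (Cphi z) => _ _ dphi _ _.
  have := derivableP df; have := derivableP dphi => ? ?.
  by apply: is_derive_eq; rewrite /GRing.scale/= [phi z * _]mulrC.
- have vanish z : ~ Omega delta z -> (f * phi) z = 0.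
    move=> /(test_function_boundary tphi) p0.
    by rewrite -[LHS]/(f z * phi z) p0 mulr0.
  by move=> y _; split; apply: vanish => -[] _ /=; rewrite in_itv/= ltxx ?andbF.
Qed.

Lemma continuous_rect_L2 (g : R * R -> R) :
  (forall z, K z -> {for z, continuous g}) -> L2 (leb2 R) (Omega delta) g.
Proof.
move=> cg; split.
  exact: measurable_continuous_Omega.
apply: (integrable_lty (measurable_Omega delta)).
apply: continuous_rect_Omega_integrable => z zK.
by apply: continuousM; exact: cg.
Qed.

(** The classical partial derivatives serve as representatives of the weak
ones. *)
Definition H1_of_C1 : H1 (Omega delta) :=
  @MkH1 R (Omega delta) f (fun z => 'D_e_theta f z) (fun z => 'D_e_r f z)
    (continuous_rect_L2 (fun z zK => let: And5 cf _ _ _ _ := Cf' zK in cf))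
    (continuous_rect_L2 (fun z zK => let: And5 _ _ _ ct _ := Cf' zK in ct))
    (continuous_rect_L2 (fun z zK => let: And5 _ _ _ _ cr := Cf' zK in cr))
    weak_derivative_theta_C1 weak_derivative_r_C1.

(** The constant sequence [f] is an admissible approximation of [f]. *)
Lemma is_trace_top_C1 : is_trace_top H1_of_C1 (fun theta => f (theta, 1)).
Proof.
have L2_cst d (T : measurableType d) (mu : {measure set T -> \bar R})
    (D : set T) (g : T -> R) : L2_cvg mu D (fun=> g) g.
  rewrite /L2_cvg (_ : (fun _ => _) = fun=> 0%E); first exact: cvg_cst.
  apply/funext => n; apply: integral0_eq => x _.
  by rewrite subrr expr0n.
split; last by exists (fun=> f); split.
have cf x : 0 <= x <= 1 -> {for x, continuous (fun t => f (t, 1))}.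
  move=> x01; apply: (@continuous_xsection _ _ x 1).
  by have [] // : _ := Cf' (_ : K (x, 1)); split; rewrite /= in_itv//= lexx ltW.
split.
  by have /integrableP[/measurable_EFinP] := continuous_itv_integrable cf.
apply: integrable_lty => //.
apply: continuous_itv_integrable => x x01.
by apply: continuousM; exact: cf.
Qed.

End C1_H1.

(** * The extremal function and the best constant *)

Section extremal.
Variables (R : realType) (delta : R).
Hypothesis delta01 : 0 < delta < 1.

Let d0 : 0 < delta. Proof. by case/andP: delta01. Qed.
Let d1 : delta < 1. Proof. by case/andP: delta01. Qed.
Let L0 : 0 < - ln delta. Proof. by rewrite oppr_gt0 ln_lt0. Qed.
Let pi0 : 0 < pi :> R. Proof. exact: pi_gt0. Qed.

(* The number k0 of the introduction: sin (k * ln r) has derivative zero at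
   r = delta, where k * ln r = - (pi / 2). *)
Let k : R := pi / 2 / - ln delta.
Let k0 : 0 < k. Proof. by rewrite !divr_gt0. Qed.

Definition extremal (z : R * R) : R := sin (k * ln z.2).

Let is_derive_kln (r : R) : 0 < r -> is_derive r 1 (fun r : R => k * ln r) (k / r).
Proof.
move=> r0; have ? := is_derive1_ln r0.
by apply: is_derive_eq; rewrite /GRing.scale/=.
Qed.

Let is_derive_sinkln (r : R) : 0 < r ->
  is_derive r 1 (fun r : R => sin (k * ln r)) (cos (k * ln r) * (k / r)).
Proof. by move=> r0; have ? := is_derive_kln r0; exact: is_derive1_comp. Qed.

Let is_derive_coskln (r : R) : 0 < r ->
  is_derive r 1 (fun r : R => cos (k * ln r)) (- sin (k * ln r) * (k / r)).
Proof. by move=> r0; have ? := is_derive_kln r0; exact: is_derive1_comp. Qed.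

Lemma extremal_dr (z : R * R) : 0 < z.2 ->
  is_derive z e_r extremal (cos (k * ln z.2) * (k / z.2)).
Proof. by case: z => x r /= r0; apply/is_derive_e_r; exact: is_derive_sinkln. Qed.

Lemma extremal_dtheta (z : R * R) : is_derive z e_theta extremal 0.
Proof.
case: z => x r; apply/is_derive_e_theta; rewrite /extremal/=.
exact: (is_derive_cst (sin (k * ln r))).
Qed.

Let U : set (R * R) := [set z | 0 < z.2].

Let continuous_snd (g : R -> R) (z : R * R) : {for z.2, continuous g} ->
  {for z, continuous (fun z : R * R => g z.2)}.
Proof. by move=> cg; apply: (cvg_comp snd g _ cg); exact: cvg_snd. Qed.

Let continuous_derivable (g : R -> R) (r l : R) :
  is_derive r 1 g l -> {for r, continuous g}.
Proof. by move=> [dg _]; apply/differentiable_continuous/derivable1_diffP. Qed.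

Lemma C1_extremal : C1_closure (Omega delta) extremal.
Proof.
have oU : open U.
  apply: (@open_comp _ _ (snd : R * R -> R) [set r | 0 < r]); last exact: open_gt.
  by move=> z _; exact: cvg_snd.
exists U; split => //.
  have cD : closed [set z : R * R | delta <= z.2].
    apply: (@closed_comp _ _ (snd : R * R -> R) [set r | delta <= r]);
      last exact: closed_ge.
    by move=> z _; exact: cvg_snd.
  have sD : Omega delta `<=` [set z : R * R | delta <= z.2].
    by move=> z /Omega_snd/andP[/ltW].
  move=> z /(closureS sD); rewrite -((closure_id _).1 cD) => dz.
  exact: lt_le_trans d0 dz.
have dtE : (fun z => 'D_e_theta extremal z) = fun=> 0.
  by apply/funext => z; apply: derive_val; exact: extremal_dtheta.
split; last split.
- move=> z Uz; apply: (@continuous_snd (fun r => sin (k * ln r))).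
  exact: continuous_derivable (is_derive_sinkln Uz).
- by move=> z _; have [] := extremal_dtheta z.
- by move=> z Uz; have [] := extremal_dr Uz.
- by rewrite dtE; split => // z _; exact: cst_continuous.
- split => // z Uz.
  have E : {near z, (fun z => cos (k * ln z.2) * (k / z.2)) =1
      (fun z => 'D_e_r extremal z)}.
    apply: filterS (open_nbhs_nbhs (conj oU Uz)) => y Uy.
    by apply/esym/derive_val; exact: extremal_dr.
  have Dz : 'D_e_r extremal z = cos (k * ln z.2) * (k / z.2).
    by apply: derive_val; exact: extremal_dr.
  rewrite /prop_for /continuous_at Dz; apply: cvg_trans (near_eq_cvg E) _.
  apply: (@continuous_snd (fun r => cos (k * ln r) * (k / r))).
  apply: continuousM; first exact: continuous_derivable (is_derive_coskln Uz).
  apply: continuousM; first exact: cst_continuous.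
  by apply: inv_continuous; rewrite gt_eqF.
Qed.

Lemma extremal_top x : extremal (x, 1) = 0.
Proof. by rewrite /extremal/= ln1 mulr0 sin0. Qed.

(** The integral over [theta] contributes the length [1] of its interval. *)
Lemma integral_radial (h : R -> R) (H : R -> R) :
  (forall r, delta <= r <= 1 -> {for r, continuous h}) ->
  (forall r, delta <= r <= 1 -> is_derive r 1 H (h r)) ->
  (\int[leb2 R]_(z in Omega delta) (h z.2)%:E = (H 1 - H delta)%:E)%E.
Proof.
move=> ch dH.
have [|-> _] := @fubini_rect R `]0, 1[ `]delta, 1[ (fun z => (h z.2)%:E)
  (measurable_itv _) (measurable_itv _).
  apply: (@continuous_rect_integrable R (fun z => h z.2)) => x y _ yd.
  by apply: (@continuous_snd h (x, y)); exact: ch.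
rewrite /= (FTC2_itvoo d1 dH ch) integral_cst//=.
by rewrite lebesgue_measure_itv/= lte_fin ltr01 -EFinB subr0 mule1.
Qed.

Let gt0 (r : R) : delta <= r <= 1 -> 0 < r.
Proof. by move=> /andP[/(lt_le_trans d0)]. Qed.

Let kL : k * ln delta = - (pi / 2).
Proof. by rewrite -[ln delta]opprK mulrN /k divfK ?gt_eqF. Qed.

(** The primitive comes from [sin ^+ 2 = (1 - cos (2 * x)) / 2], the double angle
being written with [sin * cos]; that product vanishes at both end points,
where [k * ln r] is [0] and [- (pi / 2)]. *)
Lemma integral_extremal :
  (\int[leb2 R]_(z in Omega delta) (extremal z ^+ 2 / z.2)%:E =
   (- ln delta / 2)%:E)%E.
Proof.
have ch (r : R) : delta <= r <= 1 ->
    {for r, continuous (fun r => sin (k * ln r) ^+ 2 / r)}.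
  move=> /gt0 r0; have cs := continuous_derivable (is_derive_sinkln r0).
  apply: continuousM; first by apply: continuousM.
  by apply: inv_continuous; rewrite gt_eqF.
have dH (r : R) : delta <= r <= 1 -> is_derive r 1
    (fun r => (ln r - k^-1 * (sin (k * ln r) * cos (k * ln r))) / 2)
    (sin (k * ln r) ^+ 2 / r).
  move=> /gt0 r0; have ? := is_derive_sinkln r0; have ? := is_derive_coskln r0.
  have ? := is_derive1_ln r0.
  apply: is_derive_eq; rewrite /GRing.scale/=.
  have rE : r^-1 = (cos (k * ln r) ^+ 2 + sin (k * ln r) ^+ 2) / r.
    by rewrite cos2Dsin2 mul1r.
  rewrite !mulr0 add0r [X in (X - k^-1 * _)]rE.
  by field; rewrite !gt_eqF.
rewrite (integral_radial ch dH); congr _%:E.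
rewrite ln1 mulr0 sin0 mul0r mulr0 subr0 mul0r kL.
by rewrite cosN cos_pihalf !mulr0 subr0 sub0r mulNr.
Qed.

Lemma integral_dr_extremal :
  (\int[leb2 R]_(z in Omega delta) (z.2 * 'D_e_r extremal z ^+ 2)%:E =
   (k ^+ 2 * (- ln delta / 2))%:E)%E.
Proof.
transitivity (\int[leb2 R]_(z in Omega delta)
    ((fun r => k ^+ 2 * (cos (k * ln r) ^+ 2 / r)) z.2)%:E)%E.
  apply: eq_integral => z; rewrite inE => /Omega_snd/andP[/(lt_trans d0) z0 _].
  rewrite (@derive_val _ _ _ _ _ _ _ (extremal_dr z0)); congr _%:E.
  by field; rewrite gt_eqF.
have ch (r : R) : delta <= r <= 1 ->
    {for r, continuous (fun r => k ^+ 2 * (cos (k * ln r) ^+ 2 / r))}.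
  move=> /gt0 r0; have cs := continuous_derivable (is_derive_coskln r0).
  apply: continuousM; first exact: cst_continuous.
  apply: continuousM; first by apply: continuousM.
  by apply: inv_continuous; rewrite gt_eqF.
have dH (r : R) : delta <= r <= 1 -> is_derive r 1
    (fun r => k ^+ 2 * ((ln r + k^-1 * (sin (k * ln r) * cos (k * ln r))) / 2))
    (k ^+ 2 * (cos (k * ln r) ^+ 2 / r)).
  move=> /gt0 r0; have ? := is_derive_sinkln r0; have ? := is_derive_coskln r0.
  have ? := is_derive1_ln r0.
  apply: is_derive_eq; rewrite /GRing.scale/=.
  have rE : r^-1 = (cos (k * ln r) ^+ 2 + sin (k * ln r) ^+ 2) / r.
    by rewrite cos2Dsin2 mul1r.
  rewrite !mulr0 add0r [X in (X + k^-1 * _)]rE.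
  by field; rewrite !gt_eqF.
rewrite (integral_radial ch dH); congr _%:E.
rewrite ln1 mulr0 sin0 mul0r mulr0 addr0 mul0r mulr0 sub0r kL.
by rewrite cosN cos_pihalf !mulr0 addr0 mulNr mulrN.
Qed.

(** Testing the inequality with [extremal] leaves
[- ln delta / 2 <= C * (k ^+ 2 * (- ln delta / 2))]. *)
Lemma lbound_crit_constants :
  lbound (crit_constants delta) (4 / pi ^+ 2 * `|ln delta| ^+ 2).
Proof.
move=> C /(_ (H1_of_C1 delta01 C1_extremal)) /=.
have -> : (fun=> 0) = (fun theta : R => extremal (theta, 1)).
  by apply/funext => x; rewrite extremal_top.
move=> /(_ (is_trace_top_C1 delta01 C1_extremal)).
rewrite integral_extremal integral_dr_extremal -EFinM lee_fin.
rewrite mulrA ler_pMl ?divr_gt0// => kC.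
rewrite -(ler_pM2r (exprn_gt0 2 k0)); apply: le_trans kC.
rewrite ltr0_norm ?ln_lt0// le_eqVlt; apply/orP; left; apply/eqP.
rewrite /k; move: pi0 L0; move: (pi : R) (- ln delta) => p L p0 l0.
by field; rewrite !gt_eqF.
Qed.

Lemma mem_crit_constants : crit_constants delta (4 / pi ^+ 2 * `|ln delta| ^+ 2).
Proof. by move=> u u0; exact: hardy_H1. Qed.

Lemma C_critE : C_crit delta = 4 / pi ^+ 2 * `|ln delta| ^+ 2.
Proof.
apply/eqP; rewrite eq_le; apply/andP; split.
  apply: ge_inf; last exact: mem_crit_constants.
  by exists (4 / pi ^+ 2 * `|ln delta| ^+ 2); exact: lbound_crit_constants.
apply: lb_le_inf; last exact: lbound_crit_constants.
by exists (4 / pi ^+ 2 * `|ln delta| ^+ 2); exact: mem_crit_constants.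
Qed.

End extremal.

Unset Implicit Arguments.
Theorem proposition4p1 (R : realType) :
  (forall delta : R, 0 < delta -> delta < 1 ->
     is_best_constant delta (C_crit delta) /\
     C_crit delta = 4 / pi ^+ 2 * `|ln delta| ^+ 2) /\
  (C_crit delta @[delta --> (0 : R)^'+] --> +oo) /\
  (C_crit delta / `|ln delta| ^+ 2 @[delta --> (0 : R)^'+] --> 4 / pi ^+ 2).
Proof.
have p0 : 0 < 4 / pi ^+ 2 :> R by rewrite divr_gt0// exprn_gt0// pi_gt0.
have near01 : \forall d \near (0 : R)^'+, 0 < d < 1.
  by near=> d; apply/andP; split.
split.
  move=> delta d0 d1; have d01 : 0 < delta < 1 by apply/andP.
  rewrite C_critE//; split => //.
  by split; [exact: mem_crit_constants|exact: lbound_crit_constants].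
split.
  apply/cvgryPge => A; near=> d.
  rewrite C_critE; last by near: d.
  have lnd : ln d <= - (1 + `|A| / (4 / pi ^+ 2)).
    by near: d; apply: cvgrNy_le; exact: lnNy.
  set c := 4 / pi ^+ 2 in p0 lnd *.
  have Ac : 0 <= `|A| / c by rewrite divr_ge0// ltW.
  rewrite ltr0_norm; last by lra.
  apply: le_trans (ler_norm A) _; rewrite -ler_pdivrMl// mulrC.
  move: (`|A| / c) Ac lnd => t t0 lnd; nra.
apply: cvg_near_cst; near=> d.
have d01 : 0 < d < 1 by near: d.
by rewrite C_critE// mulfK// expf_neq0// normr_eq0 lt_eqF// ln_lt0.
Unshelve. all: by end_near. Qed.
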